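(* Let $\mathcal{M}$ be an $H$-MBQC with input group $Q$, output function $o$ and phase function $\Phi$ on $Q$. Then the contextuality threshold $$1-\frac{\mathbb{H}^*(o,\Lambda_{\mathcal{O}})}{|Q|}$$ depends on the group cocycle $\Phi$ only through its cohomology class $[\Phi]\in H^1(Q,\mathcal{C}_Q)$, i.e. it is a cohomological invariant: if two $H$-MBQCs with the same input group $Q$ (and otherwise the same underlying data as specified in the context) have output functions $o,o'$ and phase functions $\Phi,\Phi'$ with $[\Phi]=[\Phi']$, then their contextuality thresholds are equal.
   Context: Observables. Fix a finite-dimensional Hilbert space. $\mathcal{O}$ is a set of observables (Hermitian operators with eigenvalues $\pm1$ only) with $A\in\mathcal{O}\Leftrightarrow -A\in\mathcal{O}$. A resolution of an observable $X$ in $\mathcal{O}$ is a product $X=A_1(A_2(\cdots(A_{K-1}A_K)))$, $K\ge 1$, $A_i\in\mathcal{O}$, such that with $B_i:=\prod_{l=i+1}^K A_l$ (in this order) $[A_i,B_i]=0$ for $i=1,\dots,K-1$. $\mathcal{I}$ is the set of all observables having a resolution in $\mathcal{O}$; it is closed under $A\mapsto -A$. $E$ is the set of classes $\{A,-A\}$, $A\in\mathcal{I}$; for each $a\in E$ a representative $T_a\in\mathcal{I}$ is fixed, so $\mathcal{I}=\{\pm T_a: a\in E\}$. $E_{\mathcal{O}}:=\{a\in E: T_a\in\mathcal{O}\}$. For $a\in E_{\mathcal{O}}$, $b\in E$ with $[T_a,T_b]=0$, $a\oplus b\in E$ is defined by $T_{a\oplus b}=\pm T_aT_b$. Chain complex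 (coefficients $\mathbb{Z}_2$). $C_1(E)$ is freely generated by $[a]$, $a\in E$; $C_2(E)$ is freely generated by the pairs $[a|b]$ for which $a\oplus b$ is defined; $\partial[a|b]=[a]+[b]+[a\oplus b]$. For $E_0\subset E$, $C_n(E,E_0):=C_n(E)/C_n(E_0)$, where $C_n(E_0)$ is spanned by the generators all of whose edges lie in $E_0$; $\partial_R$ is the induced boundary. $C_1(E,E_0)$ has basis $E\setminus E_0$. Symmetry and input groups. $H$ is a group acting on the set $\mathcal{I}$ with $h(-A)=-h(A)$. The induced action on $E$ and the phase function $\tilde\Phi_h(a)\in\mathbb{Z}_2$ are defined by $h(T_a)=(-1)^{\tilde\Phi_h(a)}T_{ha}$; $\tilde\Phi_h$ is extended linearly to 1-chains. $N=\{n\in H: na=a\ \forall a\in E\}$, and the input group is $Q=H/N$, assumed finite, acting on $E$ by $[h]a=ha$. A sequence of distinct edges $a_1,\dots,a_n\in E_{\mathcal{O}}$ is fixed, $\mathcal{E}_{\rm e}=\{a_1,\dots,a_n\}$, such that $a_{\rm e}:=a_1\oplus(a_2\oplus\cdots\oplus(a_{n-1}\oplus a_n))$ is defined. $E_0:=\{qa_{\rm e}: q\in Q\}$, and $\mathcal{E}_{\rm e}\cap E_0=\emptyset$. With $b_i:=a_{i+1}\oplus(\cdots\oplus a_n)$ (so $b_{n-1}=a_n$), $f_{\rm e}$ is the image of $\sum_{i=1}^{n-1}[a_i|b_i]$ in $C_2(E,E_0)$; $\partial_R f_{\rm e}=\sum_i a_i$. For the output function $o:Q\to\mathbb{Z}_2$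 let $\mathcal{R}_o:=\{(-1)^{o(q)}\prod_{i=1}^nT_{qa_i}: q\in Q\}$ (products in the order $1,\dots,n$). There is $\chi:E_0\to\mathbb{Z}_2$ with $\mathcal{R}_o=\{(-1)^{\chi(x)}T_x: x\in E_0\}$. $H$ is required to satisfy, for all $h\in H$: (1) $h(A)\in\mathcal{O}$ for all $A\in\mathcal{O}$; (2) $h(A)h(B)=h(AB)$ for all $A,B\in\mathcal{I}$ with $[A,B]=0$ and $AB\in\mathcal{I}$; (3) $h(\mathcal{R}_o)=\mathcal{R}_o$. Phase function on $Q$. Let $\overline\chi$ be the extension of $\chi$ to $E$ by zero, and $(\Phi_\chi)_h(a):=\tilde\Phi_h(a)+\overline\chi(ha)+\overline\chi(a)$; it vanishes for $a\in E_0$, so it is defined on $C_1(E,E_0)$. Let $C_1(\mathcal{C}_Q)\subset C_1(E,E_0)$ be the span of the chains $q\,\partial_Rf_{\rm e}$, $q\in Q$. For $x\in C_1(\mathcal{C}_Q)$, $(\Phi_\chi)_h(x)$ depends on $h$ only through $[h]\in Q$, and one sets $\Phi_{[h]}(x):=(\Phi_\chi)_h(x)$. $\Phi$ is a 1-cocycle in group cohomology: $\Phi_{q_1}(q_2x)+\Phi_{q_1q_2}(x)+\Phi_{q_2}(x)=0$. Its class $[\Phi]\in H^1(Q,\mathcal{C}_Q)$ is its class modulo coboundaries ${\tt d}\gamma$, $({\tt d}\gamma)_q(x)=\gamma(qx)+\gamma(x)$, with $\gamma:C_1(\mathcal{C}_Q)\to\mathbb{Z}_2$ linear. The $H$-MBQCs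 compared share $E$, $E_{\mathcal{O}}$, $\oplus$, the group $Q$ with its action on $E$, and the sequence $a_1,\dots,a_n$ (hence $E_0$, $f_{\rm e}$, $C_1(\mathcal{C}_Q)$). Hamming distance. $\Lambda_{\mathcal{O}}$ is the set of all functions $s:E_{\mathcal{O}}\to\mathbb{Z}_2$; $\mathbb{H}(o,o')$ is the number of $q\in Q$ with $o(q)\ne o'(q)$; $s(q\,\partial_Rf_{\rm e})=\sum_{i=1}^ns(qa_i)$; and $$\mathbb{H}^*(o,\Lambda_{\mathcal{O}}):=\min_{c\in\mathbb{Z}_2}\min_{s\in\Lambda_{\mathcal{O}}}\mathbb{H}\big(o(\cdot)+c,\ s(\,\cdot\,\partial_Rf_{\rm e})\big).$$ The contextuality threshold is a value such that an $H$-MBQC whose success probability, averaged uniformly over all inputs, exceeds it admits no non-contextual hidden variable model. *)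

(* Defs.v *)
From HB Require Import structures.
From mathcomp Require Import all_boot all_fingroup all_order all_algebra.
From mathcomp Require Import boolp classical_sets reals complex.
From mathcomp Require Import generic_quotient freeg.

Set Implicit Arguments.
Unset Strict Implicit.
Unset Printing Implicit Defensive.

Import Order.TTheory GRing.Theory Num.Theory.
Local Open Scope classical_set_scope.
Local Open Scope ring_scope.
Local Open Scope quotient_scope.

Section Observables.

(* The Hilbert space is C^(d+1): in dimension 0 an observable would equal its
   own opposite, and signs would be meaningless. *)
Variables (R : realType) (d : nat).
Local Notation op := 'M[R[i]]_d.+1.
Implicit Types (O : set op) (A X : op).

Definition observable A : Prop :=
  (A \is hermsymmx) /\ (forall z, eigenvalue A z -> z = 1 \/ z = -1).

(* The sequence s is A_1, ..., A_K; the tail product B_i is the product of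
   [drop i s]. With 0-based indices, A_(i+1) must commute with B_(i+1). *)
Definition resolution O X (s : seq op) : Prop :=
  [/\ s != [::],
      forall A, A \in s -> O A,
      X = \prod_(A <- s) A
    & forall i, (i.+1 < size s)%N ->
        GRing.comm (nth 0 s i) (\prod_(A <- drop i.+1 s) A)].

Definition inferable O : set op :=
  [set X | observable X /\ exists s, resolution O X s].

End Observables.

Section RelativeChains.

Variable K : choiceType.

(* The submodule spanned by the generators satisfying P. *)
Definition span_of (P : pred K) : {pred {freeg K / 'F_2}} :=
  fun x => all P (dom x).

Lemma span_of_zmod_closed P : zmod_closed (span_of P).
Proof.
split=> [|x y /allP Px /allP Py]; first by rewrite unfold_in dom0.
rewrite unfold_in; apply/allP => k /domB.
by rewrite mem_cat => /orP[/Px|/Py].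
Qed.

HB.instance Definition _ (P : pred K) :=
  GRing.isZmodClosed.Build {freeg K / 'F_2} (span_of P)
    (span_of_zmod_closed P).

(* A quotient of Z_2-vector spaces, of which only the additive group structure
   is recorded: over Z_2, linear is the same as additive, and the span of a
   finite family consists of its subset sums. *)
Definition relative_chains (P : pred K) := Quotient.quot (span_of P).

HB.instance Definition _ P := Quotient.on (relative_chains P).
HB.instance Definition _ P := GRing.Zmodule.on (relative_chains P).

End RelativeChains.

(* [None] stands for "undefined"; the empty sequence has no sum. *)
Fixpoint iterated_oplus (T : Type) (oplus : T -> T -> option T) (s : seq T)
    : option T :=
  match s with
  | [::] => None
  | [:: a] => Some a
  | a :: s' => obind (oplus a) (iterated_oplus oplus s')
  end.

(* The data shared by the H-MBQCs to be compared. The set E of classes {A, -A}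
   appears as an abstract index type; each H-MBQC identifies it with the set of
   classes of its own inferable observables through [rep] below. *)
Record mbqc_data := MBQCData {
  edge : choiceType;
  edgeO : {pred edge};
  oplus : edge -> edge -> option edge;
  inputGroup : finGroupType;
  inputAct : inputGroup -> edge -> edge;
  input_edges : seq edge;
  output_edge : edge;
  inputAct1 : forall a, inputAct 1%g a = a;
  inputActM : forall q r a, inputAct (q * r)%g a = inputAct q (inputAct r a);
  input_edges_uniq : uniq input_edges;
  input_edges_O : {subset input_edges <= edgeO};
  input_edges_sum : iterated_oplus oplus input_edges = Some output_edge;
  input_edges_E0 : forall a q, a \in input_edges -> a <> inputAct q output_edge
}.

Arguments edgeO : clear implicits.

Section Complex.

Variable S : mbqc_data.

Definition E0 : {pred edge S} :=
  [pred a | [exists q, a == inputAct q (output_edge S)]].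

Definition C1 := {freeg (edge S) / 'F_2}.

Definition gen2 := {p : edge S * edge S | oplus p.1 p.2}.
Definition C2 := {freeg gen2 / 'F_2}.

Definition boundary : C2 -> C1 :=
  fglift (fun g : gen2 =>
    (<< (val g).1 >> + << (val g).2 >>
     + oapp (fun c => << c >>) 0 (oplus (val g).1 (val g).2)) : C1).

(* All three edges a, b, a (+) b of [a|b] lie in E_0. *)
Definition gen2_E0 : pred gen2 := fun g =>
  [&& (val g).1 \in E0, (val g).2 \in E0
    & oapp (mem E0) false (oplus (val g).1 (val g).2)].

Definition C1rel := relative_chains (mem E0).
Definition C2rel := relative_chains gen2_E0.

(* Maps induced on the quotients are computed on representatives. *)
Definition boundaryR (x : C2rel) : C1rel := \pi_C1rel (boundary (repr x)).

Definition qchain (q : inputGroup S) : C1 -> C1 :=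
  fglift (fun a : edge S => << inputAct q a >> : C1).
Definition qchainR (q : inputGroup S) (x : C1rel) : C1rel :=
  \pi_C1rel (qchain q (repr x)).

(* The generator [a|b], or 0 if a (+) b is undefined. *)
Definition cell (a b : edge S) : C2 :=
  oapp (fun g : gen2 => << g >>) 0 (insub (a, b)).

Fixpoint fan (s : seq (edge S)) : C2 :=
  match s with
  | a :: (_ :: _) as s' =>
      oapp (cell a) 0 (iterated_oplus (@oplus S) s') + fan s'
  | _ => 0
  end.

Definition fe : C2rel := \pi_C2rel (fan (input_edges S)).

Definition C1_CQ : set C1rel :=
  [set x | exists A : {set inputGroup S},
     x = \sum_(q in A) qchainR q (boundaryR fe)].

(* Functions on C_1(C_Q) are represented by functions on C_1(E,E_0), whose
   values outside C_1(C_Q) are irrelevant. *)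
Definition linear_on_CQ (gamma : C1rel -> 'F_2) : Prop :=
  forall x y, C1_CQ x -> C1_CQ y -> gamma (x + y) = gamma x + gamma y.

Definition coboundary (gamma : C1rel -> 'F_2) (q : inputGroup S)
    (x : C1rel) : 'F_2 :=
  gamma (qchainR q x) + gamma x.

(* Equality of classes in H^1(Q, C_Q). *)
Definition cohomologous (Phi Phi' : inputGroup S -> C1rel -> 'F_2) : Prop :=
  exists gamma, linear_on_CQ gamma /\
    forall q x, C1_CQ x -> Phi q x - Phi' q x = coboundary gamma q x.

End Complex.

Arguments E0 : clear implicits.

Section Hamming.

Variable S : mbqc_data.

Definition LambdaO := {a : edge S | a \in edgeO S} -> 'F_2.

(* s(q d_R f_e) = sum_i s(q a_i); every q a_i lies in E_O. *)
Definition value_fn (s : LambdaO) (q : inputGroup S) : 'F_2 :=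
  \sum_(a <- input_edges S) oapp s 0 (insub (inputAct q a)).

Definition hamming (o o' : inputGroup S -> 'F_2) : nat :=
  #|[pred q | o q != o' q]|.

Definition hamming_value (o : inputGroup S -> 'F_2) (k : nat) : Prop :=
  exists c (s : LambdaO), k = hamming (fun q => o q + c) (value_fn s).

Lemma ex_hamming_value o : exists k, `[< hamming_value o k >].
Proof.
exists (hamming (fun q => o q + 0) (value_fn (fun=> 0))).
by apply/asboolP; exists 0, (fun=> 0).
Qed.

Definition hamming_star (o : inputGroup S -> 'F_2) : nat :=
  ex_minn (ex_hamming_value o).

End Hamming.

(* Signs are written (-1)^+ x for x : 'F_2, seen as a natural number 0 or 1. *)
Record hmbqc (R : realType) (S : mbqc_data) := HMBQC {
  hdim : nat;
  obs : set 'M[R[i]]_hdim.+1;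
  obs_observable : forall A, obs A -> observable A;
  obs_opp : forall A, obs A <-> obs (- A);

  (* rep a is T_a: a system of representatives, indexed by E, of the classes
     {A, -A} of inferable observables. *)
  rep : edge S -> 'M[R[i]]_hdim.+1;
  rep_inferable : forall a, inferable obs (rep a);
  rep_surj : forall A, inferable obs A -> exists a, A = rep a \/ A = - rep a;
  rep_inj : forall a b, rep a = rep b \/ rep a = - rep b -> a = b;

  rep_edgeO : forall a, a \in edgeO S <-> obs (rep a);
  rep_oplus : forall a b c, oplus a b = Some c <->
    [/\ a \in edgeO S, GRing.comm (rep a) (rep b)
      & rep c = rep a * rep b \/ rep c = - (rep a * rep b)];

  symGroup : groupType;
  hact : symGroup -> 'M[R[i]]_hdim.+1 -> 'M[R[i]]_hdim.+1;
  hact_inferable : forall h A, inferable obs A -> inferable obs (hact h A);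
  hact1 : forall A, inferable obs A -> hact 1%g A = A;
  hactM : forall g h A, inferable obs A -> hact (g * h)%g A = hact g (hact h A);
  hactN : forall h A, inferable obs A -> hact h (- A) = - hact h A;

  (* The induced action on E and the phase function are determined by
     [hact_rep]. *)
  eact : symGroup -> edge S -> edge S;
  phase : symGroup -> edge S -> 'F_2;
  hact_rep : forall h a, hact h (rep a) = (-1) ^+ (phase h a) * rep (eact h a);

  (* Q = H / N is given by the projection from H, a surjective morphism with
     kernel N. *)
  projQ : {multiplicative symGroup -> inputGroup S};
  projQ_surj : forall q, exists h, projQ h == q;
  projQ_ker : forall h, projQ h = 1%g <-> (forall a, eact h a = a);
  inputAct_projQ : forall h a, inputAct (projQ h) a = eact h a;

  output : inputGroup S -> 'F_2;
  Ro : set 'M[R[i]]_hdim.+1 :=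
    [set A | exists q,
       A = (-1) ^+ (output q) * \prod_(a <- input_edges S) rep (inputAct q a)];
  chi : {x : edge S | x \in E0 S} -> 'F_2;
  Ro_chi : Ro = [set A | exists x, A = (-1) ^+ (chi x) * rep (val x)];

  hact_obs : forall h A, obs A -> obs (hact h A);
  hact_mul : forall h A B,
    inferable obs A -> inferable obs B -> GRing.comm A B ->
    inferable obs (A * B) ->
    hact h A * hact h B = hact h (A * B);
  hact_Ro : forall h, hact h @` Ro = Ro
}.

Section Phase.

Variables (R : realType) (S : mbqc_data) (M : hmbqc R S).

Definition chibar (a : edge S) : 'F_2 := oapp (@chi R S M) 0 (insub a).

Definition phase_chi (h : symGroup M) (a : edge S) : 'F_2 :=
  phase h a + chibar (eact h a) + chibar a.

(* phase_chi h vanishes on E_0, hence extends linearly to C_1(E,E_0). *)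
Definition phase_chiR (h : symGroup M) (x : C1rel S) : 'F_2 :=
  fglift (phase_chi h : edge S -> ('F_2)^o) (repr x).

(* On C_1(C_Q) this does not depend on the chosen preimage of q. *)
Definition Phi (q : inputGroup S) : C1rel S -> 'F_2 :=
  phase_chiR (xchoose (projQ_surj M q)).

Definition contextuality_threshold : rat :=
  1 - (hamming_star (@output R S M))%:R / #|inputGroup S|%:R.

End Phase.

(* Main.v *)
(* Since h permutes R_o, applying h to the element of R_o that belongs to the
   input 1 gives o([h]) = o(1) + sum_i Phi~_h(a_i), that is,
   Phi_q(d_R f_e) = o(q) + o(1). If Phi - Phi' = d gamma, evaluating at d_R f_e
   shows that o + o' differs from q |-> gamma(q d_R f_e) by a constant. As gamma
   is linear on C_1(C_Q) and Q is finite, gamma(q d_R f_e) = s(q d_R f_e) for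
   some function s of the edges. Translating by s and the constant exchanges the
   Hamming distances for o with those for o'. *)

From HB Require Import structures.
Require Import Defs.
From mathcomp Require Import all_boot all_fingroup all_order all_algebra.
From mathcomp Require Import boolp classical_sets reals complex.
From mathcomp Require Import generic_quotient freeg ring.

Set Implicit Arguments.
Unset Strict Implicit.
Unset Printing Implicit Defensive.

Import GRing.Theory Num.Theory.
Local Open Scope ring_scope.
Local Open Scope quotient_scope.

(** * Arithmetic and linear algebra over F_2 *)

Lemma F2_cases (x : 'F_2) : x = 0 \/ x = 1.
Proof. by case: x => [[|[|//]] lt_x]; [left|right]; exact: val_inj. Qed.

Lemma addF2xx (x : 'F_2) : x + x = 0.
Proof. exact/addrr_pchar2/pchar_Fp. Qed.

(** Solves the cocycle identity for the second output: a, a' are the outputs at q, b, b' those at 1,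
    and v + g is the coboundary at d_R f_e. *)
Lemma F2_swap_sum (a b a' b' v g : 'F_2) :
  a + b - (a' + b') = v + g -> a' = a + (g + (b + b')) + v.
Proof.
move/(canRL (subrK _)) => abE.
have -> : a + (g + (b + b')) + v = (a + b) + (g + v + b') by ring.
rewrite abE.
have -> : v + g + (a' + b') + (g + v + b')
    = a' + ((g + v + b') + (g + v + b')) by ring.
by rewrite addF2xx addr0.
Qed.

Lemma freegF2_addxx (K : choiceType) (x : {freeg K / 'F_2}) : x + x = 0.
Proof. by rewrite -mulr2n -scaler_nat pchar_Zp ?scale0r. Qed.

HB.instance Definition _ (F : nzRingType) (K : choiceType) (V : lmodType F)
    (f : K -> V) :=
  GRing.isZmodMorphism.Build {freeg K / F} V (fglift f) (lift_is_additive f).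

Lemma fgliftU1 (F : nzRingType) (K : choiceType) (V : lmodType F)
    (f : K -> V) k :
  fglift f << k >> = f k.
Proof. by rewrite liftU scale1r. Qed.

Lemma fglift_sumE (F : nzRingType) (K : choiceType) (V : lmodType F)
    (f : K -> V) (x : {freeg K / F}) :
  fglift f x = \sum_(k <- dom x) coeff k x *: f k.
Proof.
rewrite -{1}[x]freeg_sumE raddf_sum /=.
by apply: eq_bigr => k _; rewrite liftU.
Qed.

(** Scalars of F_2 act as natural numbers, so a mere subgroup W suffices. This is the tool by which
    maps given on generators descend to relative chains. *)
Lemma fglift_span (K : choiceType) (V : lmodType 'F_2) (f : K -> V)
    (P : pred K) (W : {pred V}) x :
  zmod_closed W -> (forall k, P k -> f k \in W) ->
  x \in span_of P -> fglift f x \in W.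
Proof.
move=> [W0 WB] fW /allP xP.
have WD : {in W &, forall u v, u + v \in W}.
  by move=> u v uW vW; rewrite -[v]opprK -(sub0r v) !WB.
rewrite fglift_sumE big_seq; elim/big_ind: _ => // k /xP /fW fkW.
rewrite -[coeff k x]natr_Zp scaler_nat.
by elim: (nat_of_ord _) => [|n IHn]; rewrite ?mulr0n // mulrS WD.
Qed.

Lemma fglift_sum_sub (F : nzRingType) (K : choiceType) (V : lmodType F)
    (f : K -> V) (x : {freeg K / F}) (r : seq K) :
  uniq r -> {subset dom x <= r} ->
  fglift f x = \sum_(k <- r) coeff k x *: f k.
Proof.
move=> r_uniq xr; rewrite fglift_sumE [RHS](bigID (mem (dom x))) /=.
rewrite [X in _ + X]big1 => [|k]; last first.
  by rewrite mem_dom negbK => /eqP->; rewrite scale0r.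
rewrite addr0 -[RHS]big_filter; apply/perm_big/uniq_perm => [||k].
- exact: uniq_dom.
- exact: filter_uniq.
- by rewrite mem_filter; apply/idP/andP => [kx|[]//]; split=> //; exact: xr.
Qed.

(** Solvability criterion for a linear system over F_2: prescribed values extend to a linear
    functional as soon as they respect every relation among the x i. Finiteness of I confines the
    unknowns to the finite set r of generators that occur. *)
Lemma F2_linear_extension (K : choiceType) (I : finType)
    (x : I -> {freeg K / 'F_2}) (v : I -> 'F_2) :
  (forall A : {set I}, \sum_(i in A) x i = 0 -> \sum_(i in A) v i = 0) ->
  exists s : K -> 'F_2, forall i, fglift (s : K -> ('F_2)^o) (x i) = v i.
Proof.
move=> xv; pose r := undup (flatten [seq dom (x i) | i <- enum I]).
have xr i : {subset dom (x i) <= r}.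
  move=> k kx; rewrite mem_undup; apply/flatten_mapP.
  by exists i; rewrite ?mem_enum.
pose A := \matrix_(j < #|I|, k < size r)
  coeff (tnth (in_tuple r) k) (x (enum_val j)).
pose b : 'cV_#|I| := \col_j v (enum_val j).
(* A w = b is solvable iff b is orthogonal to the kernel of A^T, and over F_2
   a vector of that kernel is the indicator of a subset B of I. *)
have /submxP[w bE] : (b^T <= A^T)%MS.
  rewrite submxE; apply/eqP/matrixP => i0 j; rewrite !mxE.
  pose B := [set i | cokermx A^T (enum_rank i) j != 0].
  have cB i : cokermx A^T (enum_rank i) j = (i \in B)%:R.
    rewrite inE; case: (cokermx _ _ _) => [[|[|//]] lt_m]; exact: val_inj.
  have: \sum_(i in B) x i = 0.
    apply/eqP/freeg_eqP => k; rewrite raddf_sum coeff0 /=.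
    have [kr|kr] := boolP (k \in r); last first.
      apply: big1 => i _; apply/eqP; rewrite -[_ == _]negbK -mem_dom.
      by apply: contra kr => /xr.
    have := mulmx_coker A^T.
    move=> /matrixP/(_ (Ordinal (etrans (index_mem k r) kr)) j).
    rewrite !mxE (reindex_onto enum_rank enum_val) /= => [|? _];
      last exact: enum_valK.
    rewrite big_mkcond /= => Ac0k; rewrite big_mkcond /= -[RHS]Ac0k.
    apply: eq_bigr => i _; rewrite enum_rankK eqxx cB !mxE (tnth_nth k) /=.
    by rewrite nth_index // enum_rankK; case: (i \in B); rewrite ?mulr1 ?mulr0.
  move/xv => sum_v; rewrite -[RHS]sum_v.
  rewrite (reindex_onto enum_rank enum_val) /= => [|? _];
    last exact: enum_valK.
  rewrite big_mkcond [RHS]big_mkcond /=; apply: eq_bigr => i _.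
  rewrite enum_rankK eqxx cB !mxE enum_rankK.
  by case: (i \in B); rewrite ?mulr1 ?mulr0.
(* A generator outside r has index [size r], so [insub] fails and it gets the value 0; no x i
   involves it. *)
exists (fun k => oapp (w 0) 0 (insub (index k r))) => i.
rewrite (fglift_sum_sub _ (undup_uniq _) (xr i)).
have /matrixP/(_ 0 (enum_rank i)) := bE; rewrite !mxE enum_rankK => ->.
rewrite (big_tnth _ _ r) /=; apply: eq_bigr => k _.
rewrite !mxE enum_rankK mulrC; congr (_ * _).
rewrite (tnth_nth (tnth (in_tuple r) k)) /= index_uniq ?undup_uniq //.
by rewrite valK.
Qed.

(** * Representatives of relative chains and unfolding of iterated sums *)

Lemma pi_relativeE (K : choiceType) (P : pred K) (x y : {freeg K / 'F_2}) :
  \pi_(relative_chains P) x = \pi_(relative_chains P) y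
  <-> x - y \in span_of P.
Proof. by split=> [/eqP|xy]; [|apply/eqP]; rewrite -Quotient.idealrBE. Qed.

Lemma repr_pi_span (K : choiceType) (P : pred K) (x : {freeg K / 'F_2}) :
  repr (\pi_(relative_chains P) x) - x \in span_of P.
Proof. by apply/pi_relativeE; rewrite reprK. Qed.

Lemma span_of_gen (K : choiceType) (P : pred K) k :
  P k -> (<< k >> : {freeg K / 'F_2}) \in span_of P.
Proof. by move=> Pk; rewrite unfold_in domU1 /= Pk. Qed.

Lemma iterated_oplus_cons2 (T : Type) (op : T -> T -> option T) a a' s c :
  iterated_oplus op [:: a, a' & s] = Some c ->
  exists2 b, iterated_oplus op (a' :: s) = Some b & op a b = Some c.
Proof.
rewrite -[iterated_oplus _ _]/(obind (op a) (iterated_oplus op (a' :: s))).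
by case: (iterated_oplus _ _) => [b|//] abc; exists b.
Qed.

(** * The chains q d_R f_e *)

Section InputChain.

Variable S : mbqc_data.
Local Notation Q := (inputGroup S).

Lemma inputAct_E0 (q : Q) a : (inputAct q a \in E0 S) = (a \in E0 S).
Proof.
apply/existsP/existsP => -[r /eqP rE].
  exists (q^-1 * r)%g; rewrite inputActM -rE -inputActM mulVg.
  by rewrite inputAct1.
by exists (q * r)%g; rewrite inputActM rE.
Qed.

Lemma input_edge_nE0 (q : Q) a :
  a \in input_edges S -> (inputAct q a \in E0 S) = false.
Proof.
move=> ain; rewrite inputAct_E0; apply/existsP => -[r /eqP].
exact: input_edges_E0.
Qed.

Lemma boundary_cell a b c :
  oplus a b = Some c ->
  boundary (cell a b) = << a >> + << b >> + << c >> :> C1 S.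
Proof.
move=> abc; have ab : oplus (a, b).1 (a, b).2 by rewrite /= abc.
rewrite /cell /boundary; case: insubP => [g _ gE|]; last by rewrite ab.
by rewrite /= fgliftU1 gE /= abc.
Qed.

Lemma boundary_fan (s : seq (edge S)) c :
  iterated_oplus (@oplus S) s = Some c ->
  boundary (fan s) = \sum_(a <- s) << a >> + << c >> :> C1 S.
Proof.
elim: s c => [//|a [|a' s] IHs] c.
  by move=> [->]; rewrite big_seq1 freegF2_addxx /boundary raddf0.
move=> sE; have [b sb abc] := iterated_oplus_cons2 sE.
have -> : fan [:: a, a' & s] = cell a b + fan (a' :: s).
  rewrite -[LHS]/(oapp (cell a) 0 (iterated_oplus (@oplus S) (a' :: s)) + _).
  by rewrite sb.
rewrite big_cons [LHS](_ : _ = boundary (cell a b) + boundary (fan (a' :: s)));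
  last by rewrite /boundary raddfD.
rewrite (boundary_cell abc) (IHs b sb).
(* The partial sum b occurs in two consecutive cells and cancels. *)
set X := \sum_(_ <- _) _; rewrite (addrC X) (addrAC << a >>) addrA.
by rewrite -(addrA _ << b >> << b >>) freegF2_addxx addr0 addrAC.
Qed.

(** The representative of q d_R f_e in C_1(E) whose support avoids E_0. *)
Definition input_chain (q : Q) : C1 S :=
  \sum_(a <- input_edges S) << inputAct q a >>.

Lemma boundaryR_fe : boundaryR (fe S) = \pi_(C1rel S) (input_chain 1%g).
Proof.
apply/pi_relativeE.
(* Two errors, both in C_1(E_0): [repr] differs from the fan by a chain of C_2(E_0), and the
   boundary of the fan has the output edge as an extra term. *)
rewrite -(subrK (boundary (fan (input_edges S))) (boundary _)) -addrA.
apply: rpredD.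
  rewrite /boundary -raddfB.
  apply: (fglift_span (@span_of_zmod_closed _ _)) (repr_pi_span _ _) => g.
  case/and3P => g1 g2; case: (oplus _ _) => [c /= g3|//].
  by rewrite !rpredD ?span_of_gen.
rewrite (boundary_fan (input_edges_sum S)) /input_chain.
under eq_bigr do rewrite -[X in << X >>]inputAct1.
rewrite addrAC subrr add0r span_of_gen //.
by apply/existsP; exists 1%g; rewrite inputAct1.
Qed.

Lemma qchain_input_chain (q : Q) : qchain q (input_chain 1%g) = input_chain q.
Proof.
rewrite /qchain raddf_sum /=; apply: eq_bigr => a _.
by rewrite fgliftU1 inputAct1.
Qed.

(** Since Q maps E_0 to itself, the representative chosen by [repr] does not matter. *)
Lemma qchainR_fe (q : Q) :
  qchainR q (boundaryR (fe S)) = \pi_(C1rel S) (input_chain q).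
Proof.
rewrite boundaryR_fe; apply/pi_relativeE.
rewrite -(qchain_input_chain q) /qchain -raddfB.
apply: (fglift_span (@span_of_zmod_closed _ _)) (repr_pi_span _ _) => a aE0.
exact/span_of_gen/(etrans (inputAct_E0 q a)).
Qed.

End InputChain.

(** * Signs and negation of inferable observables *)

Lemma signF2D (T : pzRingType) (x y : 'F_2) :
  (-1) ^+ (x + y)%R = (-1) ^+ x * (-1) ^+ y :> T.
Proof.
case: (F2_cases x) => ->; case: (F2_cases y) => ->;
  by rewrite ?addr0 ?add0r ?addF2xx ?expr0 ?expr1 ?mulr1 ?mulrNN ?mul1r.
Qed.

Lemma signF2K (T : pzRingType) (x : 'F_2) (a : T) :
  (-1) ^+ x * ((-1) ^+ x * a) = a.
Proof. by rewrite mulrA -signF2D addF2xx mul1r. Qed.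

Section Inferable.

Variables (R : realType) (d : nat) (O : set 'M[R[i]]_d.+1).
Hypothesis ON : forall A, O A <-> O (- A).

Lemma observable_neq0 (A : 'M[R[i]]_d.+1) : observable A -> A != 0.
Proof.
move=> [_ eigA]; apply/eqP => A0.
have /eigA[/esym/eqP|/eqP] : eigenvalue A 0.
- apply/eigenvalueP; exists (delta_mx 0 0).
    by rewrite A0 mulmx0 scale0r.
  apply/eqP => /matrixP/(_ 0 0); rewrite !mxE !eqxx => /eqP.
  by rewrite oner_eq0.
- by rewrite oner_eq0.
- by rewrite eq_sym oppr_eq0 oner_eq0.
Qed.

Lemma observableN (A : 'M[R[i]]_d.+1) : observable A -> observable (- A).
Proof.
move=> [/is_hermitianmxP hA eigA]; split.
  by apply/is_hermitianmxP; rewrite {1}hA linearN /= map_mxN scalerN.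
move=> z /eigenvalueP[v vA v0].
have /eigA : eigenvalue A (- z).
  by apply/eigenvalueP; exists v => //; rewrite scaleNr -vA mulmxN opprK.
by move=> [/(canRL opprK)->|/oppr_inj->]; [right|left].
Qed.

(** Negating only the first factor of a resolution leaves all the tail products unchanged. *)
Lemma inferableN A : inferable O A -> inferable O (- A).
Proof.
move=> [obsA [s [s0 sO AE sC]]]; split; first exact: observableN.
case: s s0 sO AE sC => [|B s]; first by rewrite eqxx.
move=> _ sO AE sC.
exists (- B :: s); split=> //.
- move=> C; rewrite inE => /orP[/eqP->|Cs].
    by apply/(ON B)/sO; rewrite mem_head.
  by apply: sO; rewrite inE Cs orbT.
- by rewrite AE !big_cons mulNr.
- case=> [|i] /= lt_i; last exact: (sC i.+1).
  by apply/commr_sym/commrN/commr_sym/(sC 0).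
Qed.

Lemma inferable_sign (x : nat) A : inferable O A -> inferable O ((-1) ^+ x * A).
Proof.
move=> OA; rewrite -signr_odd mulr_sign.
by case: odd => //; apply: inferableN.
Qed.

End Inferable.

(** * Phase function and output function *)

Section PhaseFunction.

Variables (R : realType) (S : mbqc_data) (M : hmbqc R S).
Local Notation infer := (inferable (@obs R S M)).
Local Notation Ro := (@Ro R S M).

Lemma hact_sign (h : symGroup M) (x : nat) A :
  infer A -> hact h ((-1) ^+ x * A) = (-1) ^+ x * hact h A.
Proof.
move=> OA; rewrite -signr_odd !mulr_sign.
by case: odd => //; apply: hactN.
Qed.

Lemma hact_sign_rep (h : symGroup M) (x : 'F_2) a :
  hact h ((-1) ^+ x * rep M a) = (-1) ^+ (x + phase h a)%R * rep M (eact h a).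
Proof.
by rewrite hact_sign ?hact_rep ?signF2D ?mulrA//; exact: rep_inferable.
Qed.

(** The edges agree because [rep] picks one element per class; the signs agree because an observable
    is non-zero and hence differs from its opposite. *)
Lemma rep_sign_inj (x y : 'F_2) a b :
  (-1) ^+ x * rep M a = (-1) ^+ y * rep M b -> x = y /\ a = b.
Proof.
move=> xyE; have ab : a = b.
  apply: (@rep_inj R S M); rewrite -[rep M a](signF2K x) xyE mulrA -signF2D.
  by case: (F2_cases (x + y)) => ->; rewrite ?mul1r ?mulN1r; [left|right].
split=> //; move: xyE; rewrite {}ab.
have /observable_neq0 b0 := (rep_inferable M b).1.
have bN : rep M b <> - rep M b.
  move=> /eqP; rewrite -addr_eq0 -mulr2n -scaler_nat scaler_eq0 (negPf b0).
  by rewrite pnatr_eq0.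
by case: (F2_cases x) => ->; case: (F2_cases y) => ->;
  rewrite ?mul1r ?mulN1r // => E; case: bN.
Qed.

(** As chi is a function, R_o contains T_a with at most one sign. Signs can therefore be compared by
    exhibiting two members of R_o over the same edge. *)
Lemma Ro_sign_inj (x y : 'F_2) a :
  Ro ((-1) ^+ x * rep M a) -> Ro ((-1) ^+ y * rep M a) -> x = y.
Proof.
rewrite Ro_chi => -[b /rep_sign_inj[-> ab]] [c /rep_sign_inj[-> ac]].
by congr (chi _ _); apply: val_inj; rewrite -ab.
Qed.

Lemma Ro_hact (h : symGroup M) A : Ro A -> Ro (hact h A).
Proof. by move=> RA; rewrite -(hact_Ro h); exists A. Qed.

(** Both claims go through one induction: [hact_mul] applies to a head and a tail product only once
    the tail product is known to be a signed representative, hence inferable. *)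
Lemma rep_prod (h : symGroup M) s c :
  iterated_oplus (@oplus S) s = Some c ->
  (exists x : 'F_2, \prod_(a <- s) rep M a = (-1) ^+ x * rep M c)
  /\ hact h (\prod_(a <- s) rep M a) = \prod_(a <- s) hact h (rep M a).
Proof.
elim: s c => [//|a [|a' s] IHs] c.
  by move=> [->]; rewrite !big_seq1; split=> //; exists 0; rewrite mul1r.
move=> sE; have [b sb abc] := iterated_oplus_cons2 sE.
have [[x xE] hE] := IHs b sb.
rewrite big_cons [in RHS]big_cons -hE xE.
have [_ ab_comm cE] := (rep_oplus M a b c).1 abc.
have [y yE] : exists y : 'F_2, rep M a * rep M b = (-1) ^+ y * rep M c.
  case: cE => ->; [exists 0|exists 1]; rewrite ?mul1r //.
  by rewrite expr1 mulN1r opprK.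
have prodE : rep M a * ((-1) ^+ x * rep M b) = (-1) ^+ (x + y)%R * rep M c.
  by rewrite mulrA commr_sign -mulrA yE mulrA -signF2D.
split; first by exists (x + y).
rewrite -hact_mul //.
- exact: rep_inferable.
- exact/inferable_sign/rep_inferable/obs_opp.
- by apply/commrM => //; exact: commr_sign.
- by rewrite prodE; exact/inferable_sign/rep_inferable/obs_opp.
Qed.

Lemma prod_hact_rep (h : symGroup M) s :
  \prod_(a <- s) hact h (rep M a)
  = (-1) ^+ (\sum_(a <- s) phase h a)%R * \prod_(a <- s) rep M (eact h a).
Proof.
elim: s => [|a s IHs]; first by rewrite !big_nil mul1r.
rewrite !big_cons IHs hact_rep signF2D -!mulrA; congr (_ * _).
by rewrite !mulrA commr_sign.
Qed.

Lemma output_projQ (h : symGroup M) :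
  output M (projQ M h)
  = output M 1%g + \sum_(a <- input_edges S) phase h a :> 'F_2.
Proof.
have [[u uE] hE] := rep_prod h (input_edges_sum S).
have := hE; rewrite prod_hact_rep uE hact_sign_rep.
set t := \sum_(a <- _) _; set P := \prod_(a <- _) _; set c := eact h _ => tP.
have PE : P = (-1) ^+ (t + (u + phase h (output_edge S)))%R * rep M c.
  by rewrite signF2D -mulrA tP signF2K.
move: (t + _) PE => w PE.
(* Adding w, the sign exponent of P relative to T_c, turns both sides into signs of T_c. One member
   of R_o belongs to the input [h], the other is the image under h of the member for the input 1. *)
apply: (addIr w); apply: (@Ro_sign_inj _ _ c).
  rewrite signF2D -mulrA -PE; exists (projQ M h).
  by congr (_ * _); apply: eq_bigr => a _; rewrite inputAct_projQ.
rewrite !signF2D -!mulrA -PE -tP -hact_sign_rep -uE -hact_sign; last first.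
  by rewrite uE; exact/inferable_sign/rep_inferable/obs_opp.
apply: Ro_hact; exists 1%g; congr (_ * _).
by apply: eq_bigr => a _; rewrite inputAct1.
Qed.

Lemma chibarE a (aE0 : a \in E0 S) : chibar M a = chi M (Sub a aE0).
Proof. by rewrite /chibar insubT. Qed.

(** On E_0 the sign of T_x in R_o is chi(x), and h preserves R_o, so chi(ha) is chi(a) plus the
    phase. *)
Lemma phase_chi_E0 (h : symGroup M) a : a \in E0 S -> phase_chi h a = 0.
Proof.
move=> aE0; have haE0 : eact h a \in E0 S.
  by rewrite -inputAct_projQ inputAct_E0.
rewrite /phase_chi (chibarE aE0) (chibarE haE0).
have -> : chi M (Sub (eact h a) haE0) = chi M (Sub a aE0) + phase h a.
  apply: (@Ro_sign_inj _ _ (eact h a)).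
    by rewrite Ro_chi; exists (Sub (eact h a) haE0); rewrite SubK.
  rewrite -hact_sign_rep; apply: Ro_hact; rewrite Ro_chi.
  by exists (Sub a aE0); rewrite SubK.
by rewrite [chi _ _ + _]addrC addrA addF2xx add0r addF2xx.
Qed.

Lemma phase_chiR_pi (h : symGroup M) (x : C1 S) :
  phase_chiR h (\pi_(C1rel S) x)
  = fglift (phase_chi h : edge S -> ('F_2)^o) x.
Proof.
pose f : edge S -> ('F_2)^o := phase_chi h.
have : fglift f (repr (\pi_(C1rel S) x) - x) \in pred1 0.
  apply: fglift_span (repr_pi_span _ _).
    by split=> [|y z /eqP-> /eqP->]; rewrite ?subr0 inE.
  by move=> a aE0; rewrite inE [f a](phase_chi_E0 h aE0).
by rewrite raddfB inE subr_eq0 => /eqP.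
Qed.

Lemma Phi_fe q : Phi M q (boundaryR (fe S)) = output M q + output M 1%g :> 'F_2.
Proof.
rewrite /Phi; set h := xchoose _.
have hq : projQ M h = q by apply/eqP/(xchooseP (projQ_surj M q)).
rewrite boundaryR_fe phase_chiR_pi /input_chain raddf_sum /=.
rewrite -hq output_projQ addrAC addF2xx add0r big_seq [RHS]big_seq.
(* Neither a nor its translate lies in E_0, so both chi terms vanish and only the phase remains. *)
apply: eq_bigr => a ain; rewrite fgliftU1 inputAct1 /phase_chi.
rewrite /chibar -inputAct_projQ !insubF ?addr0 ?input_edge_nE0 //.
by rewrite -[a]inputAct1 input_edge_nE0.
Qed.

(** A preimage of q in H preserves the set of observables O. For input edges this ensures that
    [value_fn] never falls back on its default 0. *)
Lemma inputAct_edgeO (q : inputGroup S) a :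
  a \in edgeO S -> inputAct q a \in edgeO S.
Proof.
move=> /(rep_edgeO M); have [h /eqP<-] := projQ_surj M q.
rewrite inputAct_projQ => /(hact_obs h); rewrite hact_rep => Oha.
apply/(rep_edgeO M); move: Oha.
by case: (F2_cases (phase h a)) => ->; rewrite ?mul1r ?mulN1r // => ?;
  apply/obs_opp.
Qed.

End PhaseFunction.

(** * Invariance of the Hamming distance *)

(** As gamma is additive on C_1(C_Q) only, each partial sum has to be exhibited as a subset sum. *)
Lemma linear_on_CQ_sum (S : mbqc_data) (gamma : C1rel S -> 'F_2)
    (A : {set inputGroup S}) :
  linear_on_CQ gamma ->
  gamma (\sum_(q in A) qchainR q (boundaryR (fe S)))
  = \sum_(q in A) gamma (qchainR q (boundaryR (fe S))).
Proof.
move=> gammaD.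
have gamma0 : gamma 0 = 0.
  have C0 : C1_CQ (0 : C1rel S) by exists finset.set0; rewrite big_set0.
  have /eqP := gammaD _ _ C0 C0.
  by rewrite addr0 eq_sym -subr_eq0 addrK => /eqP.
have [n] := ubnP #|A|; elim: n A => // n IHn A.
have [->|[q qA]] := set_0Vmem A; first by rewrite !big_set0.
rewrite (cardsD1 q) qA ltnS => ltAn.
rewrite (big_setD1 q qA) [in RHS](big_setD1 q qA) -(IHn _ ltAn) gammaD.
- by [].
- by exists [set q]; rewrite big_set1.
- by exists (A :\ q).
Qed.

(** With c + c0 and s + s0 as new parameters, both compared functions change by the same summand
    s0(q d_R f_e), so they disagree at the same inputs. *)
Lemma hamming_value_shift (S : mbqc_data) (o o' : inputGroup S -> 'F_2)
    (c0 : 'F_2) (s0 : LambdaO S) k :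
  (forall q, o' q = o q + c0 + value_fn s0 q) ->
  hamming_value o k -> hamming_value o' k.
Proof.
move=> o'E [c [s ->]]; exists (c + c0), (fun a => s a + s0 a).
rewrite /hamming; apply: eq_card => q; rewrite !inE.
have -> : value_fn (fun a => s a + s0 a) q = value_fn s q + value_fn s0 q.
  rewrite /value_fn -big_split /=; apply: eq_bigr => a _.
  by case: insub => [b|] //=; rewrite addr0.
have -> : o' q + (c + c0) = o q + c + value_fn s0 q.
  by rewrite o'E (addrC c) addrACA -(addrA (o q)) addF2xx addr0 addrA addrAC.
by rewrite (inj_eq (addIr _)).
Qed.

Theorem theorem8 (R : realType) (S : mbqc_data) (M M' : hmbqc R S) :
  cohomologous (Phi M) (Phi M') ->
  contextuality_threshold M = contextuality_threshold M'.
Proof.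
move=> [gamma [gammaD PhiE]].
have [s sE] : exists s : edge S -> 'F_2, forall q,
    fglift (s : edge S -> ('F_2)^o) (input_chain q)
    = gamma (qchainR q (boundaryR (fe S))).
  (* A relation among the input chains persists in the quotient, and gamma carries it to the same
     relation among its values. *)
  apply: F2_linear_extension => A sumA; rewrite -linear_on_CQ_sum //.
  under eq_bigr do rewrite qchainR_fe.
  rewrite -raddf_sum sumA raddf0.
  have := linear_on_CQ_sum (finset.set0 : {set inputGroup S}) gammaD.
  by rewrite !big_set0.
pose s0 : LambdaO S := fun a => s (val a).
have s0E q : value_fn s0 q = gamma (qchainR q (boundaryR (fe S))).
  rewrite -sE /input_chain raddf_sum /= /value_fn big_seq [RHS]big_seq.
  apply: eq_bigr => a /input_edges_O /(inputAct_edgeO M q) qaO.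
  by rewrite fgliftU1 insubT.
pose c0 := gamma (boundaryR (fe S)) + (output M 1%g + output M' 1%g).
have outE q : output M' q = output M q + c0 + value_fn s0 q.
  have : C1_CQ (boundaryR (fe S)).
    by exists [set 1%g]; rewrite big_set1 qchainR_fe boundaryR_fe.
  move=> /(PhiE q); rewrite !Phi_fe /coboundary -s0E.
  exact: F2_swap_sum.
(* Over F_2 the shift is its own inverse, so the same c0 and s0 serve in both directions. *)
have outE' q : output M q = output M' q + c0 + value_fn s0 q.
  by rewrite outE -!(addrA _ c0) -addrA addF2xx addr0.
rewrite /contextuality_threshold; congr (1 - _%:R / _).
rewrite /hamming_star; case: ex_minnP => k /asboolP ok k_min.
case: ex_minnP => k' /asboolP ok' k'_min.
apply/eqP; rewrite eqn_leq k_min ?k'_min //; apply/asboolP.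
- exact: hamming_value_shift outE ok.
- exact: hamming_value_shift outE' ok'.
Qed.
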